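(* Let $g\in GL(2,R_{-d,f})$ be of finite order $r$, with $\det(g)=-1$ and eigenvalues $\lambda_1(g),\lambda_2(g)\in\mathbb{C}^*$ (taken up to a transposition). (i) The automorphism $g$ is of order $2$ if and only if its trace is $\mathrm{tr}(g)=0$ or, equivalently, $\lambda_1(g)=-1$, $\lambda_2(g)=1$. (ii) If $R_{-d,f}\neq\mathbb{Z}[i],\mathcal{O}_{-2},\mathcal{O}_{-3},R_{-3,2}$, then any $g\in GL(2,R_{-d,f})\setminus SL(2,R_{-d,f})$ of finite order is of order $2$. (iii) If $g\in GL(2,\mathcal{O}_{-2})$ is of finite order $r>2$ and $\det(g)=-1$, then $r=8$ and the trace $\mathrm{tr}(g)\in\{\pm\sqrt{-2}\}$. More precisely, (a) $\mathrm{tr}(g)=\sqrt{-2}$ if and only if $\lambda_1(g)=e^{\frac{\pi i}{4}}$, $\lambda_2(g)=e^{\frac{3\pi i}{4}}$; (b) $\mathrm{tr}(g)=-\sqrt{-2}$ if and only if $\lambda_1(g)=e^{\frac{5\pi i}{4}}$, $\lambda_2(g)=e^{-\frac{\pi i}{4}}$. (iv) If $g\in GL(2,\mathbb{Z}[i])$ is of finite order $r>2$ and $\det(g)=-1$, then $r\in\{4,12\}$ and the trace $\mathrm{tr}(g)\in\{\pm i,\pm2i\}$. More precisely, (a) $\mathrm{tr}(g)=2i$ exactly when $g=iI_2$; (b) $\mathrm{tr}(g)=-2i$ exactly when $g=-iI_2$; (c) $\mathrm{tr}(g)=i$ exactly when $\lambda_1(g)=e^{\frac{\pi i}{6}}$,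 $\lambda_2(g)=e^{\frac{5\pi i}{6}}$; (d) $\mathrm{tr}(g)=-i$ exactly when $\lambda_1(g)=e^{\frac{7\pi i}{6}}$, $\lambda_2(g)=e^{-\frac{\pi i}{6}}$. (v) If $g\in GL(2,R_{-3,f})$ with $R_{-3,f}\in\{R_{-3,1}=\mathcal{O}_{-3},\ R_{-3,2}=\mathbb{Z}+\sqrt{-3}\,\mathbb{Z}\}$ is of finite order $r>2$ and $\det(g)=-1$, then $r=6$ and the trace $\mathrm{tr}(g)\in\{\pm\sqrt{-3}\}$. More precisely, (a) $\mathrm{tr}(g)=\sqrt{-3}$ if and only if $\lambda_1(g)=e^{\frac{\pi i}{3}}$, $\lambda_2(g)=e^{\frac{2\pi i}{3}}$; (b) $\mathrm{tr}(g)=-\sqrt{-3}$ if and only if $\lambda_1(g)=e^{-\frac{2\pi i}{3}}$, $\lambda_2(g)=e^{-\frac{\pi i}{3}}$.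
   Context: For the integers ring $\mathcal{O}_{-d}=\mathbb{Z}+\omega_{-d}\mathbb{Z}$ of an imaginary quadratic number field $\mathbb{Q}(\sqrt{-d})$ ($d$ a square-free positive integer; $\omega_{-d}=\sqrt{-d}$ if $-d\not\equiv1\pmod 4$ and $\omega_{-d}=\frac{1+\sqrt{-d}}{2}$ if $-d\equiv1\pmod4$) and a conductor $f\in\mathbb{N}$, put $R_{-d,f}=\mathbb{Z}+f\mathcal{O}_{-d}=\mathbb{Z}+f\omega_{-d}\mathbb{Z}\subset\mathbb{C}$; moreover $R_{0,1}:=\mathbb{Z}$. These are exactly the endomorphism rings of complex elliptic curves $E$. $GL(2,R)=\{g\in R_{2\times2}:\det(g)\in R^*\}$ is viewed as a group of linear automorphisms of $E\times E$, and $SL(2,R)$ is its subgroup of matrices of determinant $1$. $\sqrt{-n}=i\sqrt{n}$ for $n>0$. *)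

(* Defs.v *)
(* The complex numbers are R[i] over an arbitrary realType R. *)
From HB Require Import structures.
From mathcomp Require Import all_boot all_order all_algebra.
From mathcomp Require Import all_classical all_reals all_analysis.
From mathcomp Require Import complex.

Set Implicit Arguments.
Unset Strict Implicit.
Unset Printing Implicit Defensive.

Import Order.TTheory GRing.Theory Num.Theory.

Local Open Scope classical_set_scope.
Local Open Scope complex_scope.
Local Open Scope ring_scope.

Definition sqrtN (R : realType) (n : nat) : R[i] := (Num.sqrt (n%:R : R)) *i.

Definition expi (R : realType) (t : R) : R[i] := cos t +i* sin t.

Definition omega (R : realType) (d : nat) : R[i] :=
  if (- d%:Z == 1 %[mod 4])%Z then (1 + sqrtN R d) / 2 else sqrtN R d.

Definition integer_ring (R : realType) (d : nat) : set R[i] :=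
  [set x | exists m n : int, x = m%:~R + n%:~R * omega R d].
Arguments integer_ring R d : clear implicits.

Definition quad_order (R : realType) (d f : nat) : set R[i] :=
  [set x | exists (m : int) (y : R[i]),
     integer_ring R d y /\ x = m%:~R + f%:R * y].
Arguments quad_order R d f : clear implicits.

Definition gaussian_integers (R : realType) : set R[i] :=
  [set x | exists m n : int, x = m%:~R + n%:~R * 'i%C].
Arguments gaussian_integers R : clear implicits.

(* The indices (d, f) of the endomorphism rings R_{-d,f}; the convention
   R_{0,1} = Z agrees with quad_order, see quad_order01 below. *)
Definition order_index (d f : nat) : Prop :=
  ((0 < d)%N /\ (forall m : nat, (m ^ 2 %| d)%N -> m = 1%N) /\ (0 < f)%N)
  \/ (d = 0%N /\ f = 1%N).

Definition units_of (C : comNzRingType) (A : set C) : set C :=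
  [set x | A x /\ exists2 y, A y & x * y = 1].

Definition GL2 (C : comNzRingType) (A : set C) : set 'M[C]_2 :=
  [set g : 'M[C]_2 | (forall i j, A (g i j)) /\ units_of A (\det g)].

Definition SL2 (C : comNzRingType) (A : set C) : set 'M[C]_2 :=
  [set g : 'M[C]_2 | GL2 A g /\ \det g = 1].

Definition has_order (C : nzRingType) (g : 'M[C]_2) (r : nat) : Prop :=
  [/\ (0 < r)%N, g ^+ r = 1
    & forall k : nat, (0 < k)%N -> (k < r)%N -> g ^+ k <> 1].

(* l1, l2 are the eigenvalues of g counted with algebraic multiplicity; the
   relation is symmetric in l1 and l2, i.e. insensitive to a transposition. *)
Definition has_eigenvalues (C : comNzRingType) (g : 'M[C]_2) (l1 l2 : C) : Prop :=
  char_poly g = ('X - l1%:P) * ('X - l2%:P).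

Lemma integer_ring1 (R : realType) : integer_ring R 1 = gaussian_integers R.
Proof.
by rewrite /integer_ring /gaussian_integers /omega /= /sqrtN sqrtr1.
Qed.

Lemma quad_orderE (R : realType) (d f : nat) : quad_order R d f =
  [set x | exists m n : int, x = m%:~R + n%:~R * (f%:R * omega R d)].
Proof.
apply/seteqP; split => x /=.
  move=> [m [y [[a [b ->]] ->]]]; exists (m + f%:Z * a), b.
  by rewrite rmorphD rmorphM /= mulrDr addrA mulrCA.
move=> [m [n ->]]; exists m, (n%:~R * omega R d); split.
  by exists 0, n; rewrite add0r.
by rewrite mulrCA.
Qed.

Lemma quad_order1 (R : realType) (d : nat) : quad_order R d 1 = integer_ring R d.
Proof. by rewrite quad_orderE mul1r. Qed.

Lemma quad_order01 (R : realType) : quad_order R 0 1 = range (fun m : int => m%:~R).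
Proof.
rewrite quad_order1 /integer_ring /omega /= /sqrtN sqrtr0.
apply/seteqP; split => x /=.
  by move=> [m [n ->]]; exists m => //; rewrite mulr0 addr0.
by move=> [m _ <-]; exists m, 0; rewrite mulr0 addr0.
Qed.

Lemma quad_order32 (R : realType) : quad_order R 3 2 =
  [set x | exists m n : int, x = m%:~R + n%:~R * sqrtN R 3].
Proof.
rewrite quad_orderE /omega /=.
have -> : 2 * ((1 + sqrtN R 3) / 2) = 1 + sqrtN R 3.
  by rewrite mulrC divfK ?pnatr_eq0.
apply/seteqP; split => x /= [m [n ->]].
  by exists (m + n), n; rewrite mulrDr mulr1 addrA rmorphD.
by exists (m - n), n; rewrite mulrDr mulr1 addrA rmorphB subrK.
Qed.

(* Main.v *)
Require Import Defs.
From HB Require Import structures.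
From mathcomp Require Import all_boot all_order all_algebra.
From mathcomp Require Import all_classical all_reals all_analysis.
From mathcomp Require Import complex ring lra zify.

(** Let [g] have determinant [-1], finite order [r] and trace [t].
    Cayley-Hamilton gives [g ^+ 2 = t *: g + 1], so the pair of eigenvalues is
    determined by [t], and [r = 2] exactly when [t = 0]. An eigenvalue [l] is a
    root of unity, hence of modulus [1], and the other one is
    [- l^-1 = - l^*]; therefore [t = l - l^* = 2 * Im l *i] is purely imaginary
    of modulus at most [2] ([finite_order_trace]).

    A purely imaginary element of [R_{-d,f}] is an integral multiple
    [k * sqrt(-d)], where [f] divides [k], or only [2 * k] when
    [-d = 1 mod 4] ([quad_order_imaginary]). With the bound on the modulus,
    [k ^ 2 * d <= 4] ([quad_order_trace]), which leaves finitely many nonzero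
    traces: [i], [2i], [sqrt(-2)] and [sqrt(-3)], up to sign. Only the rings
    that the second part excludes contain them, except that [Z[2i]] contains
    [2i] and [-2i]. If [t] is one of these two, then [g] has a double eigenvalue
    [a = i] or [a = -i], and a matrix of finite order with a double eigenvalue
    is scalar ([finite_order_double_root]); this is absurd over [Z[2i]], which
    does not contain [a], and gives [r = 4] over the Gaussian integers.
    In the second part the determinant has modulus [1], and the only elements
    of modulus [1] of the rings in question are [1] and [-1]
    ([quad_order_unit_circle]).

    For the other nonzero traces, the order is found by writing the powers of
    [g] as combinations of [g] and [1] with the quadratic equation; a power
    [a *: g + b *: 1] is told apart from [1] by its trace [a * t + b * 2]. The
    eigenvalues are of the form [expi a], [expi b] with [a + b] an odd multiple
    of [pi], so that [expi b = - (expi a)^*] and [t = 2 * sin a *i]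
    ([has_eigenvalues_expi]); the values of the sine at [pi / 6], [pi / 4] and
    [pi / 3] conclude. *)

Set Implicit Arguments.
Unset Strict Implicit.
Unset Printing Implicit Defensive.

Import Order.TTheory GRing.Theory Num.Theory.

Local Open Scope classical_set_scope.
Local Open Scope complex_scope.
Local Open Scope ring_scope.

(** * Matrices of finite order *)

Lemma has_order_dvdn (C : nzRingType) (g : 'M[C]_2) (r n : nat) :
  has_order g r -> g ^+ n = 1 <-> (r %| n)%N.
Proof.
case=> r0 gr mn; split; last by move=> /dvdnP[k ->]; rewrite mulnC exprM gr expr1n.
rewrite {1}(divn_eq n r) exprD mulnC exprM gr expr1n mul1r /dvdn => e.
have := @mn (n %% r)%N; rewrite ltn_pmod // lt0n.
by case: eqP => // _ /(_ isT isT).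
Qed.

Lemma det_exp (C : comNzRingType) (n : nat) (g : 'M[C]_n.+1) (r : nat) :
  \det (g ^+ r) = \det g ^+ r.
Proof. by elim: r => [|r IH]; rewrite ?expr0 ?det1 // !exprS -mulmxE det_mulmx IH. Qed.

Lemma norm_unity_root (C : numDomainType) (x : C) (r : nat) :
  (0 < r)%N -> x ^+ r = 1 -> `|x| = 1.
Proof.
move=> r0 xr; apply/eqP; rewrite -(@pexpr_eq1 _ _ r) //.
by rewrite -normrX xr normr1.
Qed.

Lemma eigenvalue_expn (F : fieldType) (n : nat) (g : 'M[F]_n.+1) (a : F) (r : nat) :
  eigenvalue g a -> g ^+ r = 1 -> a ^+ r = 1.
Proof.
case/eigenvalueP=> v va v0 gr.
have : v *m g ^+ r = a ^+ r *: v.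
  elim: r {gr} => [|r IH]; first by rewrite !expr0 mulmx1 scale1r.
  by rewrite !exprSr -mulmxE mulmxA IH -scalemxAl va scalerA.
rewrite gr mulmx1 -{1}[v]scale1r => /eqP.
by rewrite -subr_eq0 -scalerBl scaler_eq0 (negPf v0) orbF subr_eq0 => /eqP.
Qed.

(** In characteristic [0] the polynomial [X^r - 1] has simple roots. Concretely,
    [(a + N)^r = a^r + r a^(r-1) N] for [N = g - a] of square [0], and for
    nonzero [a] and [N] this cannot be [1]. *)
Lemma finite_order_double_root (F : numFieldType) (n r : nat) (g : 'M[F]_n.+1)
    (a : F) :
  (0 < r)%N -> g ^+ r = 1 -> a != 0 -> (g - a%:M) ^+ 2 = 0 -> g = a%:M.
Proof.
case: r => // r _ gr a0; set N := g - a%:M => N2.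
have gE : g = a%:M + N by rewrite /N subrKC.
have pw k : g ^+ k.+1 = (a ^+ k.+1)%:M + (k.+1%:R * a ^+ k) *: N.
  elim: k => [|k IH]; first by rewrite !expr1 expr0 mulr1 scale1r.
  rewrite exprS IH {1}gE mulrDl !mulrDr -!scalerAr -expr2 N2 scaler0 addr0.
  rewrite -!mulmxE mul_scalar_mx scale_scalar_mx -exprS mul_mx_scalar.
  rewrite mul_scalar_mx scalerA -addrA -scalerDl.
  by congr (_ + _ *: _); rewrite !exprS; ring.
have e : (r.+1%:R * a ^+ r) *: N = (1 - a ^+ r.+1)%:M.
  have := pw r; rewrite gr => e.
  by rewrite (raddfB (@scalar_mx F n.+1)) /= [1%:M]e addrAC subrr add0r.
(* Multiplying [e] by [N] kills its left-hand side. *)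
have : (1 - a ^+ r.+1) *: N = 0.
  by rewrite -mul_scalar_mx -e -scalemxAl mulmxE -expr2 N2 scaler0.
move/eqP; rewrite scaler_eq0 => /orP[/eqP c0|/eqP N0]; last by rewrite gE N0 addr0.
move: e; rewrite c0 raddf0 => /eqP.
rewrite scaler_eq0 mulf_eq0 pnatr_eq0 expf_eq0 (negPf a0) andbF /= => /eqP N0.
by rewrite gE N0 addr0.
Qed.

(** * Two by two matrices and their powers *)

Lemma char_poly2 (C : comNzRingType) (g : 'M[C]_2) :
  char_poly g = 'X^2 - (\tr g)%:P * 'X + (\det g)%:P.
Proof.
have c0 := char_poly_det g; have c1 := char_poly_trace g isT.
have /monicP c2 := char_poly_monic g; have sz := size_char_poly g.
move: c0 c1 c2 sz; rewrite lead_coefE; move: (char_poly g) => p c0 c1 c2 sz.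
rewrite sz /= in c2; apply/polyP => -[|[|[|k]]]; rewrite !coefE /=.
- by rewrite c0 expr2 mulrNN !mul1r mulr0 subr0 add0r.
- by rewrite c1 mulr1 add0r addr0.
- by rewrite c2 mulr0 subr0 addr0.
- by rewrite nth_default ?sz // mulr0 subr0 addr0.
Qed.

Lemma has_eigenvaluesP (C : comNzRingType) (g : 'M[C]_2) (l1 l2 : C) :
  has_eigenvalues g l1 l2 <-> \tr g = l1 + l2 /\ \det g = l1 * l2.
Proof.
rewrite /has_eigenvalues char_poly2.
have -> : ('X - l1%:P) * ('X - l2%:P)
  = 'X^2 - (l1 + l2)%:P * 'X + (l1 * l2)%:P :> {poly C}.
  by rewrite rmorphD rmorphM /=; ring.
split=> [e|[-> ->]//].
have := congr1 (fun p : {poly C} => p`_0) e.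
have := congr1 (fun p : {poly C} => p`_1) e.
rewrite !coefE /= !mulr1 !mulr0 !addr0 !add0r ?subr0 ?oppr0 ?add0r.
by move=> /oppr_inj -> ->.
Qed.

Lemma has_eigenvaluesC (C : comNzRingType) (g : 'M[C]_2) (l1 l2 : C) :
  has_eigenvalues g l1 l2 <-> has_eigenvalues g l2 l1.
Proof. by rewrite /has_eigenvalues mulrC. Qed.

Lemma sqr_mx2 (C : comNzRingType) (g : 'M[C]_2) :
  g ^+ 2 = \tr g *: g - (\det g)%:M.
Proof.
have := Cayley_Hamilton g.
rewrite char_poly2 rmorphD rmorphB rmorphXn rmorphM /= !horner_mx_X !horner_mx_C.
move/eqP; rewrite addr_eq0 subr_eq => /eqP ->.
by rewrite -mulmxE mul_scalar_mx addrC.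
Qed.

Lemma sqr_mx2_detN1 (C : comNzRingType) (g : 'M[C]_2) :
  \det g = -1 -> g ^+ 2 = \tr g *: g + 1.
Proof. by move=> dg; rewrite sqr_mx2 dg raddfN opprK. Qed.

Lemma order2_trace (C : numDomainType) (g : 'M[C]_2) (r : nat) :
  has_order g r -> \det g = -1 -> r = 2%N <-> \tr g = 0.
Proof.
move=> hr dg; have g2 := sqr_mx2_detN1 dg; split=> [r2|t0].
  have : \tr g *: g = 0.
    by apply: (addIr 1); rewrite -g2 add0r; apply/(has_order_dvdn _ hr); rewrite r2.
  move=> /(congr1 determinant) /eqP; rewrite detZ dg det0 mulrN1 oppr_eq0.
  by rewrite sqrf_eq0 => /eqP.
have : (r %| 2)%N by apply/(has_order_dvdn _ hr); rewrite g2 t0 scale0r add0r.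
rewrite dvdn_divisors // !inE => /orP[] /eqP // r1.
have g1 : g = 1 by rewrite -[g]expr1; apply/(has_order_dvdn _ hr); rewrite r1.
by move: t0; rewrite g1 mxtrace1 => /eqP; rewrite pnatr_eq0.
Qed.

Lemma order_neq2_trace (C : numDomainType) (g : 'M[C]_2) (r : nat) :
  has_order g r -> (2 < r)%N -> \det g = -1 -> \tr g != 0.
Proof. by move=> hr r2 dg; apply/eqP => /(order2_trace hr dg) re; rewrite re in r2. Qed.

(** The sum [a'] is an argument, so that each use can give it simplified. *)
Lemma exprS_detN1 (C : numDomainType) (g : 'M[C]_2) (n : nat) (a b a' : C) :
  \det g = -1 ->
  g ^+ n = a *: g + b *: 1 -> a * \tr g + b = a' ->
  g ^+ n.+1 = a' *: g + a *: 1.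
Proof.
move=> dg gn <-; rewrite exprSr gn mulrDl -!scalerAl mul1r -expr2 sqr_mx2_detN1 //.
by rewrite scalerDr scalerA addrAC -scalerDl.
Qed.

Lemma expr2_detN1 (C : numDomainType) (g : 'M[C]_2) :
  \det g = -1 -> g ^+ 2 = \tr g *: g + 1 *: 1.
Proof. by move=> dg; rewrite sqr_mx2_detN1 // scale1r. Qed.

Lemma expr_neq1_trace (C : numDomainType) (g : 'M[C]_2) (n : nat)
    (a b : C) :
  g ^+ n = a *: g + b *: 1 -> a * \tr g + b * 2 != 2 -> g ^+ n <> 1.
Proof.
move=> -> /eqP neq /(congr1 mxtrace); rewrite mxtraceD !mxtraceZ mxtrace1.
exact: neq.
Qed.

Lemma order8_detN1 (C : numDomainType) (g : 'M[C]_2) (r : nat) :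
  \det g = -1 -> has_order g r -> \tr g ^+ 2 = -2 -> r = 8%N.
Proof.
set t := \tr g => dg hr t2.
have g3 := exprS_detN1 dg (expr2_detN1 dg) (erefl (t * t + 1)).
have g4 : g ^+ 4 = 0 *: g + -1 *: 1.
  rewrite (exprS_detN1 (a' := 0) dg g3); last first.
    by rewrite mulrDl -expr2 t2; ring.
  by rewrite -expr2 t2; congr (_ + _ *: _); ring.
have n4 : ~ (r %| 4)%N.
  move=> /(has_order_dvdn _ hr); apply: expr_neq1_trace g4 _.
  by rewrite mul0r add0r mulN1r eq_sym -addr_eq0 -natrD pnatr_eq0.
have : (r %| 8)%N.
  apply/(has_order_dvdn _ hr).
  by rewrite (exprM _ 4 2) g4 scale0r add0r scaleN1r sqrrN expr1n.
by rewrite dvdn_divisors // !inE => /or4P[]/eqP re //; case: n4; rewrite re.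
Qed.

Lemma order6_detN1 (C : numDomainType) (g : 'M[C]_2) (r : nat) :
  \det g = -1 -> has_order g r -> \tr g ^+ 2 = -3 -> r = 6%N.
Proof.
set t := \tr g => dg hr t2.
have g3 : g ^+ 3 = -2 *: g + t *: 1.
  by apply: (exprS_detN1 dg (expr2_detN1 dg)); rewrite -expr2 t2; ring.
have g4 : g ^+ 4 = - t *: g + -2 *: 1.
  by apply: (exprS_detN1 dg g3); ring.
have g5 : g ^+ 5 = 1 *: g + - t *: 1.
  by apply: (exprS_detN1 dg g4); rewrite mulNr -expr2 t2; ring.
have g6 : g ^+ 6 = 0 *: g + 1 *: 1.
  by apply: (exprS_detN1 dg g5); ring.
have n2 : ~ (r %| 2)%N.
  move=> /(has_order_dvdn _ hr); apply: expr_neq1_trace (expr2_detN1 dg) _.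
  rewrite -expr2 t2; have -> : -3 + 1 * 2 = -1 :> C by ring.
  by rewrite eq_sym -addr_eq0 -(natrD C 2 1) pnatr_eq0.
have n3 : ~ (r %| 3)%N.
  move=> /(has_order_dvdn _ hr); apply: expr_neq1_trace g3 _.
  have -> : -2 * t + t * 2 = 0 by ring.
  by rewrite eq_sym pnatr_eq0.
have : (r %| 6)%N.
  by apply/(has_order_dvdn _ hr); rewrite g6 scale0r scale1r add0r.
rewrite dvdn_divisors // !inE => /or4P[]/eqP re //.
- by case: n2; rewrite re.
- by case: n2; rewrite re.
- by case: n3; rewrite re.
Qed.

Lemma order12_detN1 (C : numDomainType) (g : 'M[C]_2) (r : nat) :
  \det g = -1 -> has_order g r -> \tr g ^+ 2 = -1 -> r = 12%N.
Proof.
set t := \tr g => dg hr t2.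
have g3 : g ^+ 3 = 0 *: g + t *: 1.
  by apply: (exprS_detN1 dg (expr2_detN1 dg)); rewrite -expr2 t2; ring.
have g4 : g ^+ 4 = t *: g + 0 *: 1.
  by apply: (exprS_detN1 dg g3); ring.
have g6 : g ^+ 6 = 0 *: g + -1 *: 1.
  by rewrite (exprM _ 3 2) g3 !scale0r !add0r exprZn expr1n t2.
have n4 : ~ (r %| 4)%N.
  move=> /(has_order_dvdn _ hr); apply: expr_neq1_trace g4 _.
  by rewrite -expr2 t2 mul0r addr0 eq_sym -addr_eq0 -(natrD C 2 1) pnatr_eq0.
have n6 : ~ (r %| 6)%N.
  move=> /(has_order_dvdn _ hr); apply: expr_neq1_trace g6 _.
  by rewrite mul0r add0r mulN1r eq_sym -addr_eq0 -natrD pnatr_eq0.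
have : (r %| 12)%N.
  apply/(has_order_dvdn _ hr).
  by rewrite (exprM _ 6 2) g6 scale0r add0r scaleN1r sqrrN expr1n.
rewrite dvdn_divisors // !inE => /or4P[/eqP re|/eqP re|/eqP re|/or3P[]/eqP re] //.
- by case: n4; rewrite re.
- by case: n4; rewrite re.
- by case: n6; rewrite re.
- by case: n4; rewrite re.
- by case: n6; rewrite re.
Qed.

(** The characteristic polynomial is then [(X - a)^2]. *)
Lemma scalar_of_trace (F : numFieldType) (g : 'M[F]_2) (r : nat) (a : F) :
  has_order g r -> \det g = -1 -> a ^+ 2 = -1 -> \tr g = 2 * a -> g = a%:M.
Proof.
move=> [r0 gr _] dg a2 tg; apply: finite_order_double_root r0 gr _ _.
  by rewrite -sqrf_eq0 a2 oppr_eq0 oner_eq0.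
rewrite expr2 mulrBl !mulrBr -expr2 sqr_mx2_detN1 // tg -!mulmxE mul_mx_scalar.
rewrite !mul_scalar_mx scale_scalar_mx -expr2 a2 raddfN /= mulrDl mul1r scalerDl.
by rewrite opprK -(addrA _ _ 1) addrAC addrK subrr.
Qed.

Lemma order_scalar4 (C : comNzRingType) (g : 'M[C]_2) (r : nat) (a : C) :
  has_order g r -> (2 < r)%N -> a ^+ 2 = -1 -> g = a%:M -> r = 4%N.
Proof.
move=> hr r2 a2 gE.
have g2 : g ^+ 2 = - 1.
  by rewrite expr2 gE -mulmxE -scalar_mxM -expr2 a2 raddfN.
have : (r %| 4)%N.
  by apply/(has_order_dvdn _ hr); rewrite (exprM _ 2 2) g2 sqrrN expr1n.
by rewrite dvdn_divisors // !inE => /or3P[]/eqP re //; rewrite re in r2.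
Qed.

(** * Traces of finite order matrices over the complex numbers *)

(** The eigenvalues are [l] and [- l^-1] with [l] on the unit circle, where
    [l^-1] is the conjugate of [l]. *)
Lemma finite_order_trace (R : realType) (g : 'M[R[i]]_2) (r : nat) :
  (0 < r)%N -> g ^+ r = 1 -> \det g = -1 ->
  exists2 s : R, \tr g = s *i & s ^+ 2 <= 4.
Proof.
move=> r0 gr dg.
have [|l rl] := @closed_rootP _ (char_poly g) _; first by rewrite size_char_poly.
have nl : `|l| = 1.
  apply: norm_unity_root r0 _; apply: eigenvalue_expn gr.
  by rewrite eigenvalue_root_char.
have l0 : l != 0 by rewrite -normr_eq0 nl oner_eq0.
have tl : \tr g = l - l^*%C.
  have <- : l^-1 = l^*%C by rewrite invc_norm nl expr1n invr1 mul1r.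
  move: rl; rewrite rootE char_poly2 dg !hornerE => /eqP e.
  apply: (mulIf l0); rewrite mulrBl mulVf //.
  have -> : \tr g * l = l * l - 1 - (l ^+ 2 - \tr g * l - 1) by ring.
  by rewrite e subr0.
exists (2 * complex.Im l).
  rewrite tl subcJ -(rmorph_nat (real_complex R)).
  by apply/eqP; rewrite eq_complex /=; apply/andP; split; apply/eqP; ring.
have : (complex.Re l) ^+ 2 + (complex.Im l) ^+ 2 = 1.
  by apply: complexI; rewrite add_Re2_Im2 nl expr1n.
by have := sqr_ge0 (complex.Re l); nra.
Qed.

(** * Purely imaginary elements and elements of modulus one of the orders *)

Lemma quad_orderD (R : realType) (d f : nat) (x y : R[i]) :
  quad_order R d f x -> quad_order R d f y -> quad_order R d f (x + y).
Proof.
rewrite quad_orderE => -[m [n ->]] [m' [n' ->]].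
by exists (m + m'), (n + n'); rewrite !rmorphD /=; ring.
Qed.

Lemma quad_order_cases (R : realType) (d f : nat) (x : R[i]) :
  quad_order R d f x ->
  exists m n : int,
    if (- d%:Z == 1 %[mod 4])%Z
    then x = (m%:~R + (n * f)%:~R / 2) +i* ((n * f)%:~R / 2 * Num.sqrt d%:R)
    else x = m%:~R +i* ((n * f)%:~R * Num.sqrt d%:R).
Proof.
rewrite quad_orderE => -[m [n ->]]; exists m, n.
have iC (k : int) : k%:~R = k%:~R%:C :> R[i] by rewrite rmorph_int.
have V2 : 2^-1 = (2^-1)%:C :> R[i] by rewrite fmorphV rmorph_nat.
rewrite /omega; case: (- d%:Z == 1 %[mod 4])%Z;
  rewrite /sqrtN !iC ?V2 -!(rmorph_nat (real_complex R)) intrM;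
  apply/eqP; rewrite eq_complex /=; apply/andP; split; apply/eqP;
  rewrite /= -?pmulrn; by field.
Qed.

Lemma intr_mul_sqrt_sqr (R : realType) (b : int) (d : nat) :
  (b%:~R * Num.sqrt (d%:R : R)) ^+ 2 = (`|b| ^ 2 * d)%N%:R.
Proof.
by rewrite exprMn sqr_sqrtr // natrM natrX natr_absz intr_norm real_normK ?num_real.
Qed.

(** If [-d = 1 mod 4], then [m + n f omega] has real part [m + n f / 2], so it
    is imaginary for [n f = - 2 m], with imaginary part [- m sqrt d]. In this
    case only [f %| 2 * k] holds: [k = 1] occurs for [f = 2]. *)
Lemma quad_order_imaginary (R : realType) (d f : nat) (s : R) :
  quad_order R d f (s *i) ->
  exists k : int, [/\ s = k%:~R * Num.sqrt d%:R, (f %| `|k| * 2)%N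
    & (- d%:Z == 1 %[mod 4])%Z || (f %| `|k|)%N].
Proof.
case/quad_order_cases => m [n].
case: (boolP (- d%:Z == 1 %[mod 4])%Z) => _ [e ->] /=; last first.
  exists (n * f%:Z); split=> //; rewrite abszM absz_nat.
    by rewrite mulnAC dvdn_mull.
  by rewrite dvdn_mull.
exists (- m); have e2 : (n * f)%:~R = - (m%:~R * 2) :> R.
  by move: e; lra.
split=> //; first by rewrite e2 rmorphN /=; field.
have : n * f%:Z = - (m * 2) by apply/eqP; rewrite -(eqr_int R) e2 rmorphN rmorphM.
by rewrite abszN => nf; apply/dvdnP; exists `|n|%N; lia.
Qed.

(** The norm equation is [m^2 + (n f)^2 d = 1], or
    [(2 m + n f)^2 + (n f)^2 d = 4] if [-d = 1 mod 4]. With [n f] nonzero, the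
    former needs [d = 1] and the latter [d = 3], and in both cases [n f] is [1]
    or [-1]. *)
Lemma quad_order_unit_circle (R : realType) (d f : nat) (x : R[i]) :
  quad_order R d f x -> `|x| = 1 ->
  [\/ x = 1, x = -1, d = 1%N /\ f = 1%N | d = 3%N /\ f = 1%N].
Proof.
move=> xO nx.
have : (complex.Re x) ^+ 2 + (complex.Im x) ^+ 2 = 1.
  by apply: complexI; rewrite add_Re2_Im2 nx expr1n.
case/quad_order_cases: xO => m [n].
case: (boolP (- d%:Z == 1 %[mod 4])%Z) => d4 -> /= {x nx}.
  rewrite mulrAC expr_div_n intr_mul_sqrt_sqr; move NE: (_ * d)%N => N e.
  have eN : (2 * m + n * f) ^+ 2 + N%:Z = 4.
    apply/eqP; rewrite -(eqr_int R) rmorphD rmorphXn /= rmorphD !rmorphM /= -!pmulrn.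
    by apply/eqP; move: e; rewrite rmorphM /= -pmulrn; lra.
  have d3 : (3 <= d)%N by move: d4; clear; case: d => [|[|[|]]].
  have := sqr_ge0 (2 * m + n * f).
  have [nf0|nf0] := eqVneq (n * f) 0.
    move: e eN; rewrite -NE nf0 !addr0 absz0 mul0n exprMn => _ eN _.
    have /eqP : m ^+ 2 = 1 by lia.
    rewrite sqrf_eq1 => /orP[] /eqP ->.
      by constructor 1; rewrite !mul0r addr0.
    constructor 2; rewrite !mul0r addr0.
    by apply/eqP; rewrite eq_complex /= oppr0 !eqxx.
  move=> m0; constructor 4.
  have : (`|(n * f)%R| ^ 2 * d <= 4)%N by rewrite NE; lia.
  have : (0 < `|(n * f)%R|)%N by rewrite absz_gt0.
  move aE: `|(n * f)%R|%N => a a0 ad.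
  have a1 : a = 1%N by nia.
  move: aE; rewrite a1 abszM absz_nat => /eqP.
  by rewrite muln_eq1 => /andP[_ /eqP ->]; split=> //; move: ad; rewrite a1; lia.
rewrite intr_mul_sqrt_sqr; set N := (_ * d)%N => e.
have eN : m ^+ 2 + N%:Z = 1.
  by apply/eqP; rewrite -(eqr_int R) rmorphD rmorphXn /= -pmulrn e.
have := sqr_ge0 m.
have [N0|N0] := eqVneq N 0%N.
  have -> : (n * f)%:~R * Num.sqrt (d%:R : R) = 0.
    by apply/eqP; rewrite -sqrf_eq0 intr_mul_sqrt_sqr -/N N0.
  move: eN; rewrite N0 addr0 => /eqP.
  rewrite sqrf_eq1 => /orP[] /eqP -> _.
    by constructor 1.
  by constructor 2; apply/eqP; rewrite eq_complex /= oppr0 !eqxx.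
move=> m0; constructor 3.
have /eqP : N = 1%N by lia.
rewrite /N -mulnn !muln_eq1 abszM absz_nat muln_eq1.
by move=> /andP[/andP[/andP[_ /eqP ->] _] /eqP ->].
Qed.

Lemma imaginaryN (R : realType) (s : R) : (- s) *i = - (s *i) :> R[i].
Proof. by apply/eqP; rewrite eq_complex /= oppr0 !eqxx. Qed.

Lemma intr_mul_sqrtN (R : realType) (k : int) (d : nat) :
  k%:~R * sqrtN R d = (k%:~R * Num.sqrt d%:R) *i.
Proof.
have -> : k%:~R = k%:~R%:C :> R[i] by rewrite rmorph_int.
by apply/eqP; rewrite eq_complex /=; apply/andP; split; apply/eqP; ring.
Qed.

Lemma sqr_sqrtN (R : realType) (d : nat) : sqrtN R d ^+ 2 = - d%:R.
Proof.
rewrite -(rmorph_nat (real_complex R)) -[d%:R in RHS]sqr_sqrtr ?ler0n //.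
by apply/eqP; rewrite /sqrtN eq_complex /=; apply/andP; split; apply/eqP; ring.
Qed.

Lemma sqr_trace_sqrtN (R : realType) (d : nat) (t : R[i]) :
  t = sqrtN R d \/ t = - sqrtN R d -> t ^+ 2 = - d%:R.
Proof. by case=> ->; rewrite ?sqrrN sqr_sqrtN. Qed.

Lemma sqrtN_1 (R : realType) : sqrtN R 1 = 'i%C.
Proof. by rewrite /sqrtN sqrtr1. Qed.

(** * Determinants and traces over the orders *)

Lemma quad_order_trace (R : realType) (d f : nat) (g : 'M[R[i]]_2)
    (r : nat) :
  GL2 (quad_order R d f) g -> has_order g r -> \det g = -1 ->
  exists k : int, [/\ \tr g = k%:~R * sqrtN R d, (`|k| ^ 2 * d <= 4)%N,
    (f %| `|k| * 2)%N & (- d%:Z == 1 %[mod 4])%Z || (f %| `|k|)%N].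
Proof.
move=> [gO _] [r0 gr _] dg; have [s ts s4] := finite_order_trace r0 gr dg.
have : quad_order R d f (\tr g).
  by rewrite /mxtrace big_ord_recl big_ord1; apply: quad_orderD; apply: gO.
rewrite ts => /quad_order_imaginary[k [sk f2 f1]]; exists k; split=> //.
  by rewrite sk intr_mul_sqrtN.
by move: s4; rewrite sk intr_mul_sqrt_sqr ler_nat.
Qed.

Lemma absz_natP (k : int) (n : nat) : `|k|%N = n -> k = n%:Z \/ k = - n%:Z.
Proof. by case: k => m /= <-; [left|right; rewrite NegzE]. Qed.

Lemma trace_coeff_gt0 (R : realType) (d r : nat) (g : 'M[R[i]]_2) (k : int) :
  has_order g r -> (2 < r)%N -> \det g = -1 -> \tr g = k%:~R * sqrtN R d ->
  (0 < `|k|)%N.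
Proof.
move=> hr r2 dg tk; rewrite absz_gt0.
by apply: contra_neq (order_neq2_trace hr r2 dg) => k0; rewrite tk k0 mul0r.
Qed.

Lemma trace_sqrtN (R : realType) (d f : nat) (g : 'M[R[i]]_2) (r : nat) :
  (1 < d)%N -> GL2 (quad_order R d f) g -> has_order g r -> (2 < r)%N ->
  \det g = -1 -> \tr g = sqrtN R d \/ \tr g = - sqrtN R d.
Proof.
move=> d1 gO hr r2 dg; have [k [tk kd _ _]] := quad_order_trace gO hr dg.
have k1 : `|k|%N = 1%N.
  by have := trace_coeff_gt0 hr r2 dg tk; nia.
by rewrite tk; case: (absz_natP k1) => ->; [left|right]; rewrite ?mul1r ?mulN1r.
Qed.

Lemma det_nonspecial (R : realType) (d f : nat) (g : 'M[R[i]]_2) (r : nat) :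
  quad_order R d f <> gaussian_integers R ->
  quad_order R d f <> integer_ring R 3 ->
  GL2 (quad_order R d f) g -> has_order g r -> \det g = 1 \/ \det g = -1.
Proof.
rewrite -integer_ring1 -!quad_order1 => n1 n3 [_ [dO _]] [r0 gr _].
have nd : `|\det g| = 1.
  by apply: norm_unity_root r0 _; rewrite -det_exp gr det1.
have [| |[d1 f1]|[d3 f1]] := quad_order_unit_circle dO nd; [by left|by right| |].
  by case: n1; rewrite d1 f1.
by case: n3; rewrite d3 f1.
Qed.

(** For a nonzero trace [k sqrt(-d)], the bound [k^2 d <= 4] and the
    divisibility of [k] or [2 k] by [f] single out the four excluded orders and
    [Z[2i]]; in the last one, [g] would be the scalar matrix [i] or [-i]. *)
Lemma trace_nonspecial (R : realType) (d f : nat) (g : 'M[R[i]]_2) (r : nat) :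
  order_index d f ->
  quad_order R d f <> gaussian_integers R ->
  quad_order R d f <> integer_ring R 2 ->
  quad_order R d f <> integer_ring R 3 ->
  quad_order R d f <> quad_order R 3 2 ->
  GL2 (quad_order R d f) g -> has_order g r -> \det g = -1 -> \tr g = 0.
Proof.
rewrite -integer_ring1 -!quad_order1 => df n1 n2 n3 n4 gO hr dg.
have [k [tk kd f2 fk]] := quad_order_trace gO hr dg.
have [k0|k0] := eqVneq k 0; first by rewrite tk k0 mul0r.
case: df => [[d0 [dsf f0]]|[d0 _]]; last first.
  by rewrite tk d0 /sqrtN sqrtr0 mulr0.
have a0 : (0 < `|k|)%N by rewrite absz_gt0.
have d4 : (d <= 4)%N by nia.
case: d d0 d4 kd tk fk dsf n1 n2 n3 n4 gO =>
  // -[|[|[|[|//]]]] _ _ kd tk fk dsf n1 n2 n3 n4 gO.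
- (* [d = 1]: only [f = 2] and [\tr g = 2 * s *i] with [s] a sign remain. *)
  have fk' : (f %| `|k|)%N by exact: fk.
  have [f1|f1] := eqVneq f 1%N; first by case: n1; rewrite f1.
  have fle := dvdn_leq a0 fk'.
  have k2 : (`|k| = 2)%N by nia.
  have fE : f = 2%N by lia.
  have [s s2 ts] : exists2 s : R, s ^+ 2 = 1 & \tr g = 2 * s *i.
    have i2 : (2 : R[i]) * sqrtN R 1 = 2 * 1 *i by rewrite sqrtN_1.
    rewrite tk; case: (absz_natP k2) => ->.
      by exists 1; rewrite ?expr1n.
    exists (-1); first by rewrite sqrrN expr1n.
    by rewrite rmorphN mulNr i2 imaginaryN mulrN.
  have si2 : (s *i) ^+ 2 = -1.
    apply/eqP; rewrite eq_complex /= -(expr2 s) s2.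
    by apply/andP; split; apply/eqP; ring.
  have gE := scalar_of_trace hr dg si2 ts.
  have := gO.1 0 0; rewrite gE mxE eqxx mulr1n fE.
  case/quad_order_imaginary => k' [sk _ /= k'2].
  move: s2; rewrite sk intr_mul_sqrt_sqr => /eqP; rewrite (eqr_nat _ _ 1).
  by rewrite muln1 -mulnn muln_eq1 => /andP[/eqP k'1 _]; rewrite k'1 in k'2.
- have fk' : (f %| `|k|)%N by exact: fk.
  have k1 : `|k|%N = 1%N by nia.
  by move: fk'; rewrite k1 dvdn1 => /eqP f1; case: n2; rewrite f1.
- have k1 : `|k|%N = 1%N by nia.
  move: f2; rewrite k1 mul1n dvdn_divisors // !inE => /orP[]/eqP fE.
    by case: n3; rewrite fE.
  by case: n4; rewrite fE.
- (* [d = 4] is not square-free. *)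
  by have := dsf 2%N isT.
Qed.

(** * Eigenvalues on the unit circle *)

(** With [s = sin (pi / 6)], the triple-angle formula for [sin (pi / 2) = 1]
    reads [(2 s - 1)^2 (s + 1) = 0]. *)
Lemma sin_pi6 (R : realType) : sin (pi / 6) = 1 / 2 :> R.
Proof.
have p0 := @pi_gt0 R.
have s0 : 0 < sin (pi / 6 : R) by apply: sin_gt0_pi; lra.
have e : sin (pi / 6 *+ 2 + pi / 6) = 1 :> R.
  have -> : pi / 6 *+ 2 + pi / 6 = pi / 2 :> R by rewrite mulr2n; lra.
  exact: sin_pihalf.
have c2 := cos2sin2 (pi / 6 : R).
move: e; rewrite sinD cos_mulr2n sin_mulr2n; move: s0 c2.
move: (sin _) (cos _) => s c s0 c2 e.
have e1 : (2 * s - 1) ^+ 2 * (s + 1) = 0.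
  have -> : (2 * s - 1) ^+ 2 * (s + 1)
    = 1 - (c * s *+ 2 * c + (c ^+ 2 *+ 2 - 1) * s)
      + 4 * s * (c ^+ 2 - (1 - s ^+ 2)).
    by ring.
  by rewrite e c2; ring.
move/eqP: e1; rewrite mulf_eq0 sqrf_eq0 => /orP[] /eqP; lra.
Qed.

Lemma sin_pi3 (R : realType) : sin (pi / 3) = Num.sqrt 3 / 2 :> R.
Proof.
have p0 := @pi_gt0 R.
have s0 : 0 < sin (pi / 3 : R) by apply: sin_gt0_pi; lra.
have c : cos (pi / 3) = 1 / 2 :> R.
  by rewrite -sin_pi6 -cosBpihalf -cosN; congr cos; lra.
have := cos2Dsin2 (pi / 3 : R); rewrite c => e.
apply/eqP; rewrite -(@eqrXn2 _ 2) ?divr_ge0 ?sqrtr_ge0 ?ltW //.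
by rewrite expr_div_n sqr_sqrtr //; apply/eqP; lra.
Qed.

Lemma sin_pi4 (R : realType) : sin (pi / 4) = Num.sqrt 2 / 2 :> R.
Proof.
have p0 := @pi_gt0 R.
have s0 : 0 < sin (pi / 4 : R) by apply: sin_gt0_pi; lra.
have c : cos (pi / 4) = sin (pi / 4) :> R.
  by rewrite -cosBpihalf -cosN; congr cos; lra.
have := cos2Dsin2 (pi / 4 : R); rewrite c => e.
apply/eqP; rewrite -(@eqrXn2 _ 2) ?divr_ge0 ?sqrtr_ge0 ?ltW //.
by rewrite expr_div_n sqr_sqrtr //; apply/eqP; lra.
Qed.

(** Since [expi (a + b) = -1], the second eigenvalue is [- (expi a)^*]. *)
Lemma has_eigenvalues_expi (R : realType) (g : 'M[R[i]]_2) (a b : R) :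
  \det g = -1 -> cos (a + b) = -1 ->
  has_eigenvalues g (expi a) (expi b) <-> \tr g = (2 * sin a) *i.
Proof.
move=> dg cab.
have sab : sin (a + b) = 0.
  by apply/eqP; rewrite -sqrf_eq0 sin2cos2 cab sqrrN expr1n subrr.
have cb : cos b = - cos a.
  by rewrite -[b](addKr a) addrC cosB cab sab; ring.
have sb : sin b = sin a.
  by rewrite -[b](addKr a) addrC sinB cab sab; ring.
have s2 : expi a + expi b = (2 * sin a) *i.
  apply/eqP; rewrite /expi cb sb eq_complex /=.
  by apply/andP; split; apply/eqP; ring.
have p2 : expi a * expi b = -1.
  apply/eqP; rewrite /expi cb sb eq_complex /=.
  have := cos2Dsin2 a => h; apply/andP; split; apply/eqP; last by ring.
  by rewrite -h; ring.
by rewrite has_eigenvaluesP s2 p2; split=> [[]|].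
Qed.

Theorem proposition16 (R : realType) :
  (* (i) *)
  (forall (d f : nat) (g : 'M[R[i]]_2) (r : nat),
     order_index d f -> GL2 (quad_order R d f) g -> has_order g r ->
     \det g = -1 ->
     (r = 2%N <-> \tr g = 0) /\ (\tr g = 0 <-> has_eigenvalues g (-1) 1))
  /\
  (* (ii) *)
  (forall d f : nat, order_index d f ->
     quad_order R d f <> gaussian_integers R ->
     quad_order R d f <> integer_ring R 2 ->
     quad_order R d f <> integer_ring R 3 ->
     quad_order R d f <> quad_order R 3 2 ->
     forall g : 'M[R[i]]_2,
       (GL2 (quad_order R d f) `\` SL2 (quad_order R d f)) g ->
       (exists r : nat, has_order g r) -> has_order g 2)
  /\
  (* (iii) *)
  (forall (g : 'M[R[i]]_2) (r : nat),
     GL2 (integer_ring R 2) g -> has_order g r -> (2 < r)%N -> \det g = -1 ->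
     [/\ r = 8%N,
         \tr g = sqrtN R 2 \/ \tr g = - sqrtN R 2,
         \tr g = sqrtN R 2 <->
           has_eigenvalues g (expi (pi / 4)) (expi (3 * pi / 4))
       & \tr g = - sqrtN R 2 <->
           has_eigenvalues g (expi (5 * pi / 4)) (expi (- (pi / 4)))])
  /\
  (* (iv) *)
  (forall (g : 'M[R[i]]_2) (r : nat),
     GL2 (gaussian_integers R) g -> has_order g r -> (2 < r)%N ->
     \det g = -1 ->
     (r = 4%N \/ r = 12%N)
     /\ [\/ \tr g = 'i%C, \tr g = - 'i%C, \tr g = 2 * 'i%C | \tr g = - (2 * 'i%C)]
     /\ [/\ \tr g = 2 * 'i%C <-> g = 'i%C%:M,
            \tr g = - (2 * 'i%C) <-> g = (- 'i%C)%:M,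
            \tr g = 'i%C <->
              has_eigenvalues g (expi (pi / 6)) (expi (5 * pi / 6))
          & \tr g = - 'i%C <->
              has_eigenvalues g (expi (7 * pi / 6)) (expi (- (pi / 6)))])
  /\
  (* (v) *)
  (forall (f : nat) (g : 'M[R[i]]_2) (r : nat),
     (0 < f)%N ->
     quad_order R 3 f = integer_ring R 3 \/ quad_order R 3 f = quad_order R 3 2 ->
     GL2 (quad_order R 3 f) g -> has_order g r -> (2 < r)%N -> \det g = -1 ->
     [/\ r = 6%N,
         \tr g = sqrtN R 3 \/ \tr g = - sqrtN R 3,
         \tr g = sqrtN R 3 <->
           has_eigenvalues g (expi (pi / 3)) (expi (2 * pi / 3))
       & \tr g = - sqrtN R 3 <->
           has_eigenvalues g (expi (- (2 * pi / 3))) (expi (- (pi / 3)))]).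
Proof.
split; [|split; [|split; [|split]]].
- move=> d f g r _ _ hr dg; split; first exact: order2_trace.
  by rewrite has_eigenvaluesP dg addNr mulr1; split=> [|[]].
- move=> d f df n1 n2 n3 n4 g [gO gS] [r hr].
  have dg : \det g = -1.
    by case: (det_nonspecial n1 n3 gO hr) => // dg; case: gS.
  have t0 := trace_nonspecial df n1 n2 n3 n4 gO hr dg.
  by move/(order2_trace hr dg): t0 => <-.
- move=> g r; rewrite -quad_order1 => gO hr r2 dg.
  have t2 : \tr g = sqrtN R 2 \/ \tr g = - sqrtN R 2
    by exact: trace_sqrtN gO hr r2 dg.
  split=> //.
  + exact: (order8_detN1 dg hr (sqr_trace_sqrtN t2)).
  + rewrite has_eigenvalues_expi // ?sin_pi4.
      by rewrite mulrC divfK ?pnatr_eq0.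
    by rewrite -cospi; congr cos; field.
  + rewrite has_eigenvaluesC has_eigenvalues_expi // ?sinN ?sin_pi4.
      by rewrite mulrN imaginaryN mulrC divfK ?pnatr_eq0.
    by rewrite -cospi; congr cos; field.
- move=> g r; rewrite -integer_ring1 -quad_order1 => gO hr r2 dg.
  have [k [tk kd _ _]] := quad_order_trace gO hr dg.
  have k12 : `|k|%N = 1%N \/ `|k|%N = 2%N.
    by have := trace_coeff_gt0 hr r2 dg tk; nia.
  rewrite sqrtN_1 in tk.
  have i2 : 'i%C ^+ 2 = -1 :> R[i] := sqr_i R.
  have sc a : a ^+ 2 = -1 -> \tr g = 2 * a <-> g = a%:M.
    move=> a2; split; first exact: scalar_of_trace hr dg a2.
    by move=> ->; rewrite mxtrace_scalar mulr_natl.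
  split; last split.
  + case: k12 => ka; [right|left].
      apply: (order12_detN1 dg hr); rewrite tk.
      by case: (absz_natP ka) => ->; rewrite ?mulN1r ?mul1r ?sqrrN.
    have ia (a : R[i]) : a ^+ 2 = -1 -> \tr g = 2 * a -> r = 4%N.
      by move=> a2 /(sc _ a2); apply: order_scalar4 hr r2 a2.
    case: (absz_natP ka) => ke; rewrite ke ?rmorphN ?mulNr in tk.
      exact: ia tk.
    by rewrite -mulrN in tk; apply: ia tk; rewrite sqrrN.
  + by case: k12 => /absz_natP[] ke; move: tk; rewrite ke ?mulrNz ?mulNr ?mul1r => ->;
      [constructor 1|constructor 2|constructor 3|constructor 4].
  + split.
    * exact: sc.
    * by rewrite -mulrN; apply: sc; rewrite sqrrN.
    * rewrite has_eigenvalues_expi // ?sin_pi6.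
        by rewrite mulrC divfK ?pnatr_eq0.
      by rewrite -cospi; congr cos; field.
    * rewrite has_eigenvaluesC has_eigenvalues_expi // ?sinN ?sin_pi6.
        by rewrite mulrN imaginaryN mulrC divfK ?pnatr_eq0.
      by rewrite -cospi; congr cos; field.
- move=> f g r _ _ gO hr r2 dg.
  have t2 : \tr g = sqrtN R 3 \/ \tr g = - sqrtN R 3
    by exact: trace_sqrtN gO hr r2 dg.
  split=> //.
  + exact: (order6_detN1 dg hr (sqr_trace_sqrtN t2)).
  + rewrite has_eigenvalues_expi // ?sin_pi3.
      by rewrite mulrC divfK ?pnatr_eq0.
    by rewrite -cospi; congr cos; field.
  + rewrite has_eigenvaluesC has_eigenvalues_expi // ?sinN ?sin_pi3.
      by rewrite mulrN imaginaryN mulrC divfK ?pnatr_eq0.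
    by rewrite -cospi -cosN; congr cos; field.
Qed.
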